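(* Every partial complete Boolean algebra $A$ is, in the category $\mathbf{PCBoolean}$, the colimit of the diagram of its total subalgebras (ordered by inclusion, with the inclusion maps as transition morphisms), the colimiting cocone being given by the inclusions into $A$.
   Context: A partial Boolean algebra is a set $A$ with a reflexive and symmetric relation $\odot\subseteq A\times A$ (commeasurability), elements $0,1\in A$, a total unary operation $\lnot\colon A\to A$, and partial binary operations $\land,\lor\colon\odot\to A$, such that every set $S\subseteq A$ of pairwise commeasurable elements is contained in a set $T\subseteq A$ whose elements are also pairwise commeasurable and on which the operations determine a Boolean algebra structure. A partial complete Boolean algebra is a partial Boolean algebra $A$ together with a partial operation $\bigvee\colon\{X\subseteq A\mid X\times X\subseteq\odot\}\to A$ such that every set $S\subseteq A$ of pairwise commeasurable elements is contained in a set $T\subseteq A$ whose elements are also pairwise commeasurable, and on which $0,1,\lnot,\land,\lor,\bigvee$ determine a complete Boolean algebra structure (so $T$ contains $0,1$ and is closed under $\lnot,\land,\lor$ and $\bigvee$, and $\bigvee$ gives the suprema in $T$). A morphism is a function preserving commeasurability and all the algebraic structure, including $\bigvee$, whenever defined. The resulting category is $\mathbf{PCBoolean}$. A total subalgebra of a partial complete Boolean algebra $A$ is a subset of pairwise commeasurable elements containing $0,1$ and closed under $\lnot,\land,\lor$ and $\bigvee$. *)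

(* Defs.v *)
From mathcomp Require Import all_boot boolp classical_sets.

Set Implicit Arguments.
Unset Strict Implicit.
Unset Printing Implicit Defensive.

Local Open Scope classical_set_scope.

(* The one-element algebra (zero = one) is allowed. *)
Record is_boolean_algebra (B : Type) (zero one : B) (neg : B -> B)
    (meet join : B -> B -> B) : Prop := IsBooleanAlgebra {
  ba_meetC : commutative meet;
  ba_joinC : commutative join;
  ba_meetA : associative meet;
  ba_joinA : associative join;
  ba_meetK : forall x y, meet x (join x y) = x;
  ba_joinK : forall x y, join x (meet x y) = x;
  ba_meetDr : right_distributive meet join;
  ba_joinDr : right_distributive join meet;
  ba_join0 : right_id zero join;
  ba_meet1 : right_id one meet;
  ba_meetN : right_inverse zero neg meet;
  ba_joinN : right_inverse one neg join }.

(* The order is x <= y iff meet x y = x. *)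
Record is_complete_boolean_algebra (B : Type) (zero one : B) (neg : B -> B)
    (meet join : B -> B -> B) (sup : set B -> B) : Prop :=
  IsCompleteBooleanAlgebra {
  cba_boolean : is_boolean_algebra zero one neg meet join;
  cba_sup_ub : forall (X : set B) x, X x -> meet x (sup X) = x;
  cba_sup_least : forall (X : set B) b,
    (forall x, X x -> meet x b = x) -> meet (sup X) b = sup X }.

Definition pairwise (T : Type) (R : T -> T -> Prop) (X : set T) : Prop :=
  forall x y, X x -> X y -> R x y.

Record pba_data := PbaData {
  pba_sort :> Type;
  comm : pba_sort -> pba_sort -> Prop;
  pzero : pba_sort;
  pone : pba_sort;
  pneg : pba_sort -> pba_sort;
  pmeet : forall x y, comm x y -> pba_sort;
  pjoin : forall x y, comm x y -> pba_sort }.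

Arguments comm {_} _ _.
Arguments pzero {_}.
Arguments pone {_}.
Arguments pneg {_} _.
Arguments pmeet {_} x y _.
Arguments pjoin {_} x y _.

Record closed_ops (D : pba_data) (T : set D) : Prop := ClosedOps {
  closed_zero : T pzero;
  closed_one : T pone;
  closed_neg : forall x, T x -> T (pneg x);
  closed_meet : forall x y (h : comm x y), T x -> T y -> T (pmeet x y h);
  closed_join : forall x y (h : comm x y), T x -> T y -> T (pjoin x y h) }.

Definition closed_sup (D : pba_data)
    (sup : forall X : set D, pairwise comm X -> D) (T : set D) : Prop :=
  forall (X : set D) (h : pairwise comm X), X `<=` T -> T (sup X h).

(* On a closed set T of pairwise commeasurable elements, the partial operations
   restrict to total operations on the subtype of T. *)
Section Restriction.
Variables (D : pba_data) (T : set D).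
Hypotheses (cT : pairwise comm T) (clT : closed_ops T).

Definition restr_zero : {x | T x} := exist T pzero (closed_zero clT).
Definition restr_one : {x | T x} := exist T pone (closed_one clT).
Definition restr_neg (u : {x | T x}) : {x | T x} :=
  exist T (pneg (sval u)) (closed_neg clT (svalP u)).
Definition restr_meet (u v : {x | T x}) : {x | T x} :=
  exist T (pmeet (sval u) (sval v) (cT (svalP u) (svalP v)))
    (closed_meet clT _ (svalP u) (svalP v)).
Definition restr_join (u v : {x | T x}) : {x | T x} :=
  exist T (pjoin (sval u) (sval v) (cT (svalP u) (svalP v)))
    (closed_join clT _ (svalP u) (svalP v)).

Lemma image_sval_sub (X : set {x | T x}) : sval @` X `<=` T.
Proof. by move=> _ [u _ <-]; exact: svalP. Qed.

Lemma image_sval_pairwise (X : set {x | T x}) : pairwise comm (sval @` X).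
Proof. by move=> x y /image_sval_sub Tx /image_sval_sub Ty; exact: cT. Qed.

Variable sup : forall X : set D, pairwise comm X -> D.
Hypothesis clsT : closed_sup sup T.

Definition restr_sup (X : set {x | T x}) : {x | T x} :=
  exist T (sup (image_sval_pairwise (X:=X)))
    (clsT (image_sval_pairwise (X:=X)) (image_sval_sub (X:=X))).

End Restriction.

Definition boolean_on (D : pba_data) (T : set D) : Prop :=
  exists (cT : pairwise comm T) (clT : closed_ops T),
    is_boolean_algebra (restr_zero clT) (restr_one clT) (restr_neg clT)
      (restr_meet cT clT) (restr_join cT clT).

Record partial_boolean_algebra := PartialBooleanAlgebra {
  pba_pba_data :> pba_data;
  comm_refl : forall x : pba_pba_data, comm x x;
  comm_sym : forall x y : pba_pba_data, comm x y -> comm y x;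
  pba_extend : forall S : set pba_pba_data, pairwise comm S ->
    exists T : set pba_pba_data, S `<=` T /\ boolean_on T }.

Definition complete_boolean_on (D : pba_data)
    (sup : forall X : set D, pairwise comm X -> D) (T : set D) : Prop :=
  exists (cT : pairwise comm T) (clT : closed_ops T) (clsT : closed_sup sup T),
    is_complete_boolean_algebra (restr_zero clT) (restr_one clT) (restr_neg clT)
      (restr_meet cT clT) (restr_join cT clT) (restr_sup cT clsT).

Record partial_complete_boolean_algebra := PartialCompleteBooleanAlgebra {
  pcba_pba :> partial_boolean_algebra;
  psup : forall X : set pcba_pba, pairwise comm X -> pcba_pba;
  pcba_extend : forall S : set pcba_pba, pairwise comm S ->
    exists T : set pcba_pba, S `<=` T /\ complete_boolean_on psup T }.

Arguments psup {_} X _.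

(* In the clauses for the partial operations the right-hand side is defined,
   by mor_comm; its proof of definedness is quantified universally. *)
Record pcba_mor (A B : partial_complete_boolean_algebra) := PcbaMor {
  mor_fun :> A -> B;
  mor_comm : forall x y, comm x y -> comm (mor_fun x) (mor_fun y);
  mor_zero : mor_fun pzero = pzero;
  mor_one : mor_fun pone = pone;
  mor_neg : forall x, mor_fun (pneg x) = pneg (mor_fun x);
  mor_meet : forall x y (h : comm x y) (h' : comm (mor_fun x) (mor_fun y)),
    mor_fun (pmeet x y h) = pmeet (mor_fun x) (mor_fun y) h';
  mor_join : forall x y (h : comm x y) (h' : comm (mor_fun x) (mor_fun y)),
    mor_fun (pjoin x y h) = pjoin (mor_fun x) (mor_fun y) h';
  mor_sup : forall (X : set A) (h : pairwise comm X)
      (h' : pairwise comm (mor_fun @` X)),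
    mor_fun (psup X h) = psup (mor_fun @` X) h' }.

Lemma pcba_mor_eq A B (f g : pcba_mor A B) : f =1 g -> f = g.
Proof.
move=> /funext; case: f => f ? ? ? ? ? ? ?; case: g => g ? ? ? ? ? ? ? /= fg.
subst g; congr PcbaMor; exact: Prop_irrelevance.
Qed.

Lemma psup_eq (A : partial_complete_boolean_algebra) (X Y : set A)
  (hX : pairwise comm X) (hY : pairwise comm Y) : X = Y -> psup X hX = psup Y hY.
Proof. by move=> XY; subst Y; congr psup; exact: Prop_irrelevance. Qed.

Lemma mor_pairwise A B (f : pcba_mor A B) (X : set A) :
  pairwise comm X -> pairwise comm (f @` X).
Proof. by move=> h _ _ [x Xx <-] [y Xy <-]; apply: mor_comm; exact: h. Qed.

Program Definition pcba_id A : pcba_mor A A := @PcbaMor A A id _ _ _ _ _ _ _.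
Next Obligation. by congr pmeet; exact: Prop_irrelevance. Qed.
Next Obligation. by congr pjoin; exact: Prop_irrelevance. Qed.
Next Obligation. by apply: psup_eq; rewrite image_id. Qed.

Program Definition pcba_comp A B C (g : pcba_mor B C) (f : pcba_mor A B) :
  pcba_mor A C := @PcbaMor A C (g \o f) _ _ _ _ _ _ _.
Next Obligation. by do 2![apply: mor_comm]. Qed.
Next Obligation. by rewrite !mor_zero. Qed.
Next Obligation. by rewrite !mor_one. Qed.
Next Obligation. by rewrite !mor_neg. Qed.
Next Obligation. by rewrite (mor_meet _ (mor_comm f h)) (mor_meet _ h'). Qed.
Next Obligation. by rewrite (mor_join _ (mor_comm f h)) (mor_join _ h'). Qed.
Next Obligation.
have h1 := mor_pairwise (f:=f) h; have h2 := mor_pairwise (f:=g) h1.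
by rewrite (mor_sup h h1) (mor_sup h1 h2); apply: psup_eq; rewrite image_comp.
Qed.

Record category := Category {
  obj :> Type;
  hom : obj -> obj -> Type;
  idm : forall a, hom a a;
  comp : forall a b c, hom b c -> hom a b -> hom a c;
  comp_idl : forall a b (f : hom a b), comp (idm b) f = f;
  comp_idr : forall a b (f : hom a b), comp f (idm a) = f;
  comp_assoc : forall a b c d (h : hom c d) (g : hom b c) (f : hom a b),
    comp h (comp g f) = comp (comp h g) f }.

Arguments idm {_} a.
Arguments comp {_ a b c} g f.

Record functor (J C : category) := Functor {
  fobj :> J -> C;
  fmap : forall i j, hom i j -> hom (fobj i) (fobj j);
  fmap_id : forall i, fmap (idm i) = idm (fobj i);
  fmap_comp : forall i j k (g : hom j k) (f : hom i j),
    fmap (comp g f) = comp (fmap g) (fmap f) }.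

Arguments fmap {J C} F {i j} f : rename.

Record cocone (J C : category) (F : functor J C) (c : C) := Cocone {
  leg :> forall j, hom (F j) c;
  leg_natural : forall i j (f : hom i j), comp (leg j) (fmap F f) = leg i }.

Definition is_colimit (J C : category) (F : functor J C) (c : C)
    (k : cocone F c) : Prop :=
  forall (d : C) (l : cocone F d),
    exists! u : hom c d, forall j, comp u (k j) = l j.

Definition PCBoolean : category.
Proof.
refine (@Category partial_complete_boolean_algebra pcba_mor pcba_id pcba_comp
  _ _ _) => *; exact: pcba_mor_eq.
Defined.

Record total_subalgebra (A : partial_complete_boolean_algebra) :=
  TotalSubalgebra {
  tsub_set :> set A;
  tsub_comm : pairwise comm tsub_set;
  tsub_closed : closed_ops tsub_set;
  tsub_closed_sup : closed_sup (@psup A) tsub_set }.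

Definition tsub_category (A : partial_complete_boolean_algebra) : category.
Proof.
refine (@Category (total_subalgebra A)
  (fun T U => tsub_set T `<=` tsub_set U)
  (fun T => @subset_refl _ T)
  (fun T U V UV TU => subset_trans TU UV) _ _ _) => *;
  exact: Prop_irrelevance.
Defined.

Lemma boolean_transfer (B C : Type) zB oB nB mB jB zC oC nC mC jC
    (i : B -> C) :
  injective i -> i zB = zC -> i oB = oC ->
  (forall x, i (nB x) = nC (i x)) ->
  (forall x y, i (mB x y) = mC (i x) (i y)) ->
  (forall x y, i (jB x y) = jC (i x) (i y)) ->
  is_boolean_algebra zC oC nC mC jC -> is_boolean_algebra zB oB nB mB jB.
Proof.
move=> inji iz io iN im ij [mC' jC' mA jA mK jK mD jD j0 m1 mN jN].
by split; (move=> x y z || move=> x y || move=> x); apply: inji;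
  rewrite ?(im, ij, iN, iz, io) //.
Qed.

Lemma complete_boolean_transfer (B C : Type) zB oB nB mB jB sB
    zC oC nC mC jC sC (i : B -> C) :
  injective i -> i zB = zC -> i oB = oC ->
  (forall x, i (nB x) = nC (i x)) ->
  (forall x y, i (mB x y) = mC (i x) (i y)) ->
  (forall x y, i (jB x y) = jC (i x) (i y)) ->
  (forall X, i (sB X) = sC (i @` X)) ->
  is_complete_boolean_algebra zC oC nC mC jC sC ->
  is_complete_boolean_algebra zB oB nB mB jB sB.
Proof.
move=> inji iz io iN im ij iS [bC ub lub]; split.
- exact: (boolean_transfer inji iz io iN im ij bC).
- by move=> X x Xx; apply: inji; rewrite im iS; apply: ub; exists x.
- move=> X b hb; apply: inji; rewrite im iS; apply: lub => _ [x Xx <-].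
  by rewrite -im hb.
Qed.

Lemma sval_inj (S : Type) (P : S -> Prop) (u v : {x | P x}) :
  sval u = sval v -> u = v.
Proof.
by case: u v => [a pa] [b pb] /= ab; subst b; congr exist; exact: Prop_irrelevance.
Qed.

(* A total subalgebra, viewed as a partial complete Boolean algebra with the
   commeasurability and the operations inherited from A. *)
Section SubPcba.
Variables (A : partial_complete_boolean_algebra) (T : total_subalgebra A).

Definition tsub_data : pba_data :=
  @PbaData {x : A | tsub_set T x} (fun u v => comm (sval u) (sval v))
    (restr_zero (tsub_closed T)) (restr_one (tsub_closed T))
    (restr_neg (tsub_closed T))
    (fun u v h => exist _ (pmeet (sval u) (sval v) h)
      (closed_meet (tsub_closed T) h (svalP u) (svalP v)))
    (fun u v h => exist _ (pjoin (sval u) (sval v) h)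
      (closed_join (tsub_closed T) h (svalP u) (svalP v))).

Definition tsub_sup (X : set tsub_data) (_ : pairwise comm X) : tsub_data :=
  restr_sup (@tsub_comm A T) (@tsub_closed_sup A T) X.

Lemma tsub_complete_boolean : complete_boolean_on tsub_sup setT.
Proof.
have cT : pairwise (@comm tsub_data) setT.
  by move=> u v _ _; exact: (tsub_comm (svalP u) (svalP v)).
have clT : closed_ops (D := tsub_data) setT by split.
have clsT : closed_sup tsub_sup setT by [].
exists cT, clT, clsT.
have [U [TU [cU [clU [clsU cba]]]]] := pcba_extend (@tsub_comm A T).
pose i (u : {x : tsub_data | setT x}) : {x : A | U x} :=
  exist U (sval (sval u)) (TU _ (svalP (sval u))).
apply: (complete_boolean_transfer (i := i) _ _ _ _ _ _ _ cba).
- by move=> u v /(congr1 sval) /= uv; do 2![apply: sval_inj].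
- exact: sval_inj.
- exact: sval_inj.
- by move=> u; exact: sval_inj.
- by move=> u v; apply: sval_inj; congr pmeet; exact: Prop_irrelevance.
- by move=> u v; apply: sval_inj; congr pjoin; exact: Prop_irrelevance.
- by move=> X; apply: sval_inj; apply: psup_eq; rewrite !image_comp.
Qed.

Lemma tsub_pcba_extend (S : set tsub_data) : pairwise comm S ->
  exists U : set tsub_data, S `<=` U /\ complete_boolean_on tsub_sup U.
Proof. by move=> _; exists setT; split=> //; exact: tsub_complete_boolean. Qed.

Lemma tsub_pba_extend (S : set tsub_data) : pairwise comm S ->
  exists U : set tsub_data, S `<=` U /\ boolean_on U.
Proof.
move=> /tsub_pcba_extend[U [SU [cU [clU [_ [bU _ _]]]]]].
by exists U; split=> //; exists cU, clU.
Qed.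

Definition tsub_pba : partial_boolean_algebra :=
  @PartialBooleanAlgebra tsub_data (fun u => comm_refl (sval u))
    (fun u v h => comm_sym h) tsub_pba_extend.

Definition tsub_pcba : partial_complete_boolean_algebra :=
  @PartialCompleteBooleanAlgebra tsub_pba tsub_sup tsub_pcba_extend.

Program Definition tsub_inclusion : pcba_mor tsub_pcba A :=
  @PcbaMor tsub_pcba A sval _ _ _ _ _ _ _.
Next Obligation. by congr pmeet; exact: Prop_irrelevance. Qed.
Next Obligation. by congr pjoin; exact: Prop_irrelevance. Qed.
Next Obligation. exact: psup_eq. Qed.

End SubPcba.

Program Definition tsub_transition (A : partial_complete_boolean_algebra)
    (T U : total_subalgebra A) (TU : tsub_set T `<=` tsub_set U) :
    pcba_mor (tsub_pcba T) (tsub_pcba U) :=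
  @PcbaMor (tsub_pcba T) (tsub_pcba U)
    (fun u => exist _ (sval u) (TU _ (svalP u))) _ _ _ _ _ _ _.
Next Obligation. exact: sval_inj. Qed.
Next Obligation. exact: sval_inj. Qed.
Next Obligation. exact: sval_inj. Qed.
Next Obligation. by apply: sval_inj; congr pmeet; exact: Prop_irrelevance. Qed.
Next Obligation. by apply: sval_inj; congr pjoin; exact: Prop_irrelevance. Qed.
Next Obligation. by apply: sval_inj; apply: psup_eq; rewrite image_comp. Qed.

Definition tsub_diagram (A : partial_complete_boolean_algebra) :
  functor (tsub_category A) PCBoolean.
Proof.
refine (@Functor (tsub_category A) PCBoolean (@tsub_pcba A)
  (@tsub_transition A) _ _) => *; apply: pcba_mor_eq => u; exact: sval_inj.
Defined.

Definition tsub_cocone (A : partial_complete_boolean_algebra) :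
  cocone (tsub_diagram A) (A : PCBoolean).
Proof.
refine (@Cocone _ _ (tsub_diagram A) A (@tsub_inclusion A) _) => *.
exact: pcba_mor_eq.
Defined.

(* Main.v *)
From mathcomp Require Import all_boot boolp classical_sets.
Require Import Defs.

Set Implicit Arguments.
Unset Strict Implicit.
Unset Printing Implicit Defensive.

Local Open Scope classical_set_scope.

(** Every set of pairwise commeasurable elements lies in a total subalgebra, so
    a cocone [l] can only be factored by [x |-> l T x] for any [T] containing
    [x]. The value does not depend on [T]: for two subalgebras [T] and [U]
    containing [x], both [l T x] and [l U x] equal the value of [l] on the total
    subalgebra [T `&` U]. Each instance of a morphism axiom involves a single
    pairwise commeasurable set, hence holds because it does for the leg at a
    total subalgebra containing that set. *)

(** The type of the commeasurability proof mentions both arguments, so these are replaced together;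
    proof irrelevance then identifies the proofs. *)
Lemma pmeet_eq (D : pba_data) (x y x' y' : D) (h : comm x y) (h' : comm x' y') :
  x = x' -> y = y' -> pmeet x y h = pmeet x' y' h'.
Proof. by move=> ex ey; subst x' y'; congr pmeet; exact: Prop_irrelevance. Qed.

Lemma pjoin_eq (D : pba_data) (x y x' y' : D) (h : comm x y) (h' : comm x' y') :
  x = x' -> y = y' -> pjoin x y h = pjoin x' y' h'.
Proof. by move=> ex ey; subst x' y'; congr pjoin; exact: Prop_irrelevance. Qed.

Lemma pairwise_comm_set2 (A : partial_boolean_algebra) (x y : A) :
  comm x y -> pairwise comm [set x; y].
Proof.
by move=> h _ _ [->|->] [->|->] //; [exact: comm_refl|exact: comm_sym|
  exact: comm_refl].
Qed.

Section TotalSubalgebras.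
Variable A : partial_complete_boolean_algebra.

Lemma total_subalgebra_ext (S : set A) : pairwise comm S ->
  exists T : total_subalgebra A, S `<=` T.
Proof.
move=> /pcba_extend[T [ST [cT [clT [clsT _]]]]].
by exists (TotalSubalgebra cT clT clsT).
Qed.

Lemma total_subalgebra_ext2 (x y : A) : comm x y ->
  exists T : total_subalgebra A, tsub_set T x /\ tsub_set T y.
Proof.
move=> /pairwise_comm_set2/total_subalgebra_ext[T ST].
by exists T; split; apply: ST; [left|right].
Qed.

Lemma total_subalgebra_ext1 (x : A) :
  exists T : total_subalgebra A, tsub_set T x.
Proof.
by have [T [Tx _]] := total_subalgebra_ext2 (comm_refl x); exists T.
Qed.

Lemma tsubI_comm (T U : total_subalgebra A) :
  pairwise comm (tsub_set T `&` tsub_set U).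
Proof. by move=> x y [Tx _] [Ty _]; exact: (tsub_comm Tx Ty). Qed.

Lemma tsubI_closed (T U : total_subalgebra A) :
  closed_ops (tsub_set T `&` tsub_set U).
Proof.
have [T0 T1 TN TM TJ] := tsub_closed T.
have [U0 U1 UN UM UJ] := tsub_closed U.
split=> //; first by move=> x [/TN ? /UN].
- by move=> x y h [Tx Ux] [Ty Uy]; split; [exact: TM|exact: UM].
- by move=> x y h [Tx Ux] [Ty Uy]; split; [exact: TJ|exact: UJ].
Qed.

Lemma tsubI_closed_sup (T U : total_subalgebra A) :
  closed_sup (@psup A) (tsub_set T `&` tsub_set U).
Proof. by move=> X h XTU; split; apply: tsub_closed_sup => x /XTU[]. Qed.

Definition tsubI (T U : total_subalgebra A) : total_subalgebra A :=
  TotalSubalgebra (@tsubI_comm T U) (@tsubI_closed T U) (@tsubI_closed_sup T U).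

Section Gluing.
Variables (B : partial_complete_boolean_algebra).
Variable l : cocone (tsub_diagram A) (B : PCBoolean).

(** Unfolds the hom-type of [PCBoolean], so that the leg can be applied to elements. *)
Definition cocone_leg (T : total_subalgebra A) : pcba_mor (tsub_pcba T) B :=
  leg l T.

(** Naturality of [l] at the inclusion of [T] in [U], whose transition map fixes underlying
    elements. *)
Lemma cocone_legS (T U : total_subalgebra A) (TU : tsub_set T `<=` tsub_set U)
    x (Tx : tsub_set T x) (Ux : tsub_set U x) :
  cocone_leg U (exist _ x Ux) = cocone_leg T (exist _ x Tx).
Proof.
rewrite /cocone_leg -(@leg_natural _ _ _ _ l T U TU) /=; congr mor_fun.
exact: sval_inj.
Qed.

Lemma cocone_leg_indep (T U : total_subalgebra A) x
    (Tx : tsub_set T x) (Ux : tsub_set U x) :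
  cocone_leg T (exist _ x Tx) = cocone_leg U (exist _ x Ux).
Proof.
have TUx : tsub_set (tsubI T U) x by [].
by transitivity (cocone_leg (tsubI T U) (exist _ x TUx)); [|apply/esym];
  apply: cocone_legS => y [].
Qed.

Definition glue (x : A) : B :=
  let: exist T Tx := cid (total_subalgebra_ext1 x) in
  cocone_leg T (exist _ x Tx).

(** Removes the choice made by [cid]: on any convenient [T], [glue] can be traded for the leg at
    [T], which is a morphism. *)
Lemma glueE (T : total_subalgebra A) (v : tsub_pcba T) :
  glue (sval v) = cocone_leg T v.
Proof.
case: v => x Tx; rewrite /glue /=.
by case: cid => U Ux; exact: cocone_leg_indep.
Qed.

Lemma glue_comm x y : comm x y -> comm (glue x) (glue y).
Proof.
move=> h; have [T [Tx Ty]] := total_subalgebra_ext2 h.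
rewrite (glueE (exist _ x Tx : tsub_pcba T)).
by rewrite (glueE (exist _ y Ty : tsub_pcba T)); exact: mor_comm.
Qed.

Lemma glue_zero : glue pzero = pzero.
Proof.
(* Any total subalgebra serves, since its own zero lies over [pzero]. *)
have [T _] := total_subalgebra_ext1 pzero.
by rewrite (glueE (pzero : tsub_pcba T)) mor_zero.
Qed.

Lemma glue_one : glue pone = pone.
Proof.
have [T _] := total_subalgebra_ext1 pone.
by rewrite (glueE (pone : tsub_pcba T)) mor_one.
Qed.

Lemma glue_neg x : glue (pneg x) = pneg (glue x).
Proof.
have [T Tx] := total_subalgebra_ext1 x; pose v : tsub_pcba T := exist _ x Tx.
by rewrite (glueE (pneg v)) (glueE v) mor_neg.
Qed.

Lemma glue_meet x y (h : comm x y) (h' : comm (glue x) (glue y)) :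
  glue (pmeet x y h) = pmeet (glue x) (glue y) h'.
Proof.
have [T [Tx Ty]] := total_subalgebra_ext2 h.
pose v : tsub_pcba T := exist _ x Tx; pose w : tsub_pcba T := exist _ y Ty.
have vw : comm v w := h.
(* Meets in [tsub_pcba T] are computed in [A], so the meet of [x] and [y] can be formed inside
   [T]. *)
have -> : pmeet x y h = sval (pmeet v w vw) by exact: pmeet_eq.
rewrite glueE (mor_meet _ (mor_comm (cocone_leg T) vw)).
by apply: pmeet_eq; rewrite -glueE.
Qed.

Lemma glue_join x y (h : comm x y) (h' : comm (glue x) (glue y)) :
  glue (pjoin x y h) = pjoin (glue x) (glue y) h'.
Proof.
have [T [Tx Ty]] := total_subalgebra_ext2 h.
pose v : tsub_pcba T := exist _ x Tx; pose w : tsub_pcba T := exist _ y Ty.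
have vw : comm v w := h.
have -> : pjoin x y h = sval (pjoin v w vw) by exact: pjoin_eq.
rewrite glueE (mor_join _ (mor_comm (cocone_leg T) vw)).
by apply: pjoin_eq; rewrite -glueE.
Qed.

Lemma glue_sup (X : set A) (h : pairwise comm X)
    (h' : pairwise comm (glue @` X)) :
  glue (psup X h) = psup (glue @` X) h'.
Proof.
have [T XT] := total_subalgebra_ext h.
(* [Y] is [X] seen inside [T]; it projects onto all of [X] because [T] contains [X]. *)
pose Y : set (tsub_pcba T) := [set v | X (sval v)].
have XY : X = sval @` Y.
  apply/seteqP; split=> [x Xx|_ [v Yv <-]//].
  by exists (exist _ x (XT _ Xx)).
have hY : pairwise comm Y by move=> v w; exact: h.
(* A supremum in [tsub_pcba T] is the supremum in [A] of the underlying set, here [X]. *)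
have -> : psup X h = sval (psup Y hY) by exact: psup_eq.
rewrite glueE (mor_sup hY (mor_pairwise (f := cocone_leg T) hY)).
apply: psup_eq; rewrite [in RHS]XY image_comp.
by apply: eq_imagel => v _ /=; rewrite glueE.
Qed.

Definition glue_mor : pcba_mor A B :=
  PcbaMor glue_comm glue_zero glue_one glue_neg glue_meet glue_join glue_sup.

End Gluing.
End TotalSubalgebras.

Theorem theorem7 (A : PCBoolean) : is_colimit (tsub_cocone A).
Proof.
move=> B l; exists (glue_mor l); split=> [T|u ul].
  by apply: pcba_mor_eq => v; exact: glueE.
(* Uniqueness at [x]: for [T] containing [x], the equation [ul] at [T] forces [u x] to be the value
   of the leg there. *)
apply: pcba_mor_eq => x /=; have [T Tx] := total_subalgebra_ext1 x.
by rewrite (glueE l (exist _ x Tx : tsub_pcba T)) /cocone_leg -ul.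
Qed.
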